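(* Let $\Sigma$ be a finite alphabet and let $X\subset\Sigma^{\mathbb Z}$ be a subshift that is presented by a contractive measure $\lambda$-graph system. Then $X$ has property $g$, and $X$ has property $(D)$.
   Context: Subshifts. A subshift $X\subset\Sigma^{\mathbb Z}$ is a closed shift-invariant set; a finite word is admissible if it appears in a point of $X$. For an interval $I$ of integers, $X_I=\{(x_j)_{j\in I}:x\in X\}$. For a word $a\in X_{(-k,0]}$, $\Gamma_\infty^-(a)$ is the set of $y^-\in X_{(-\infty,-k]}$ with $(y^-,a)\in X_{(-\infty,0]}$, and $\omega_1^+(a)=\{\sigma\in\Sigma:(y^-,a,\sigma)\in X_{(-\infty,1]}\text{ for all }y^-\in\Gamma_\infty^-(a)\}$ (words are considered up to translation of indices). For a word $b$, $\Gamma^-(b)$ is the set of words $a$ such that $ab$ is admissible. For $x^-\in X_{(-\infty,0]}$, $\Delta_1^+(x^-)=\bigcup_{n\in\mathbb N}\omega_1^+(x^-_{[-n,0]})$. $X$ has property $g$ if $\Delta_1^+(x^-)\ne\emptyset$ for all $x^-\in X_{(-\infty,0]}$. $X$ has property $(D)$ if for all admissible words $b\sigma$ of $X$ ($b$ a word, $\sigma\in\Sigma$) there exists a word $a\in\Gamma^-(b)$ such that $\sigma\in\omega_1^+(ab)$. Measure $\lambda$-graph systems. $\mathcal M(\Sigma)$ is the set of Borel probability measures on $\Sigma^{\mathbb N}$; $C(a)\subset\Sigma^{\mathbb N}$ is the cylinder of sequences beginning with the word $a$. For $\sigma\in\Sigma$ and $\mu\in\mathcal M(\Sigma)$ with $\mu(C(\sigma))>0$,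 $\tau_\sigma(\mu)\in\mathcal M(\Sigma)$ is given by $\tau_\sigma(\mu)(C(b))=\mu(C(\sigma b))/\mu(C(\sigma))$. Similarly, let $\mathcal M_N(\Sigma)$ be the set of probability vectors on $\Sigma^N$ ($N\ge1$) and $\mathcal M_0(\Sigma)=\{\emptyset\}$ (a single vertex). For $N\ge1$ and $\mu\in\mathcal M_N(\Sigma)$ giving positive mass to $\{a\in\Sigma^N:a_1=\sigma\}$, $\tau_\sigma(\mu)\in\mathcal M_{N-1}(\Sigma)$ is $\tau_\sigma(\mu)(b)=\mu(\sigma b)/\mu(\{a\in\Sigma^N:a_1=\sigma\})$ if $N>1$, and $\tau_\sigma(\mu)=\emptyset$ if $N=1$; there is then an edge labeled $\sigma$ from $\mu$ to $\tau_\sigma(\mu)$. For a word $a=a_1\dots a_n$ set $\tau_a=\tau_{a_n}\circ\cdots\circ\tau_{a_1}$ wherever defined. A set $\mathcal M\subset\mathcal M(\Sigma)$ is transition complete if $\mu\in\mathcal M$, $\sigma\in\Sigma$, $\mu(C(\sigma))>0$ imply $\tau_\sigma(\mu)\in\mathcal M$; it is in-complete if for every $\mu\in\mathcal M$ there are $\nu\in\mathcal M$ and $\sigma\in\Sigma$ with $\nu(C(\sigma))>0$ and $\tau_\sigma(\nu)=\mu$. The measure $\lambda$-graph system of a transition complete and in-complete $\mathcal M$ is the labeled directed graph with vertex set $\bigcup_{N\in\mathbb Z_+}\mathcal M_N$, where for $N\ge 1$ $\mathcal M_N\subset\mathcal M_N(\Sigma)$ is the set of marginals on the first $N$ coordinates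 of the measures in $\mathcal M$, and $\mathcal M_0=\{\emptyset\}$, with edges given by the $\tau_\sigma$. It presents $X$ if the set of admissible words of $X$ coincides with the set of label sequences of finite paths in it. A measure $\lambda$-graph system $\bigcup_N\mathcal M_N$ presenting $X$ is contractive if for all $x^-\in X_{(-\infty,0]}$ $$\lim_{n\to\infty}\operatorname{diam}\{\tau_{x^-_{(-n,0]}}(\mu):\mu\in\mathcal M_{n+1},\ \tau_{x^-_{(-n,0]}}(\mu)\text{ is defined}\}=0,$$ the diameter being taken in $\mathcal M_1(\Sigma)\subset\mathbb R^\Sigma$. *)

(* Defs.v *)
From HB Require Import structures.
From mathcomp Require Import all_boot all_order all_algebra.
From mathcomp Require Import all_classical all_reals all_analysis.
Set Implicit Arguments.
Unset Strict Implicit.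
Unset Printing Implicit Defensive.
Import Order.TTheory GRing.Theory Num.Theory.
Import numFieldNormedType.Exports.
Local Open Scope classical_set_scope.
Local Open Scope ring_scope.

(* Finite nonempty alphabets; measurable types of the library are pointed. *)
#[short(type="alphabetType")]
HB.structure Definition Alphabet := {T of Finite T & Pointed T}.

Section Subshifts.
Context {S : alphabetType}.

Definition biseq : topologicalType :=
  prod_topology (fun _ : int => discrete_topology S).

Definition bishift (x : biseq) : biseq := fun i => x (i + 1).

Definition subshift (X : set biseq) : Prop :=
  closed X /\ bishift @^-1` X = X.

Definition admissible (X : set biseq) (w : seq S) : Prop :=
  exists2 x, X x &
    exists i : int, w = [seq (x (i + j%:Z) : S) | j <- iota 0 (size w)].

(* X_(-oo, 0]. A left-infinite sequence is indexed by its distance to the right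
   end: y i is the letter at coordinate - i. As indices only matter up to
   translation, [past X] also stands for every X_(-oo, k]. *)
Definition past (X : set biseq) : set (nat -> S) :=
  [set y | exists2 x, X x & forall i : nat, y i = x (- i%:Z)].

(* The left-infinite sequence (y, a). *)
Definition past_cat (y : nat -> S) (a : seq S) : nat -> S :=
  fun i => if (i < size a)%N then nth point (rev a) i else y (i - size a)%N.

(* The word formed by the last n letters of y, in order. *)
Definition past_word (y : nat -> S) (n : nat) : seq S := rev (mkseq y n).

Definition Gamma_inf (X : set biseq) (a : seq S) : set (nat -> S) :=
  [set y | past X y /\ past X (past_cat y a)].

Definition omega1 (X : set biseq) (a : seq S) : set S :=
  [set s | forall y, Gamma_inf X a y -> past X (past_cat y (rcons a s))].

Definition Gamma (X : set biseq) (b : seq S) : set (seq S) :=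
  [set a | admissible X (a ++ b)].

(* The letters at coordinates [-n, 0] are the last n + 1 ones. *)
Definition Delta1 (X : set biseq) (y : nat -> S) : set S :=
  \bigcup_(n : nat) omega1 X (past_word y n.+1).

Definition property_g (X : set biseq) : Prop :=
  forall y, past X y -> Delta1 X y !=set0.

Definition property_D (X : set biseq) : Prop :=
  forall (b : seq S) (s : S), admissible X (rcons b s) ->
    exists2 a, Gamma X b a & omega1 X (a ++ b) s.

End Subshifts.
Arguments biseq : clear implicits.

Section Measures.
Context {R : realType} {S : alphabetType}.

Definition fwdseq : topologicalType :=
  prod_topology (fun _ : nat => discrete_topology S).

Definition borel_fwdseq := @g_sigma_algebraType (nat -> S) (@open fwdseq).

Definition cylinder (a : seq S) : set borel_fwdseq :=
  [set x | mkseq x (size a) = a].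

Definition mass (mu : probability borel_fwdseq R) (a : seq S) : R :=
  fine (mu (cylinder a)).

(* [is_tau s mu nu] means nu = tau_s(mu), for mass mu [:: s] > 0. The values on
   cylinders determine a Borel measure; Leibniz equality in [probability] would
   also compare values on non-measurable sets. *)
Definition is_tau (s : S) (mu nu : probability borel_fwdseq R) : Prop :=
  forall b, mass nu b = mass mu (s :: b) / mass mu [:: s].

Definition transition_complete (M : set (probability borel_fwdseq R)) : Prop :=
  forall mu s, M mu -> 0 < mass mu [:: s] -> exists2 nu, M nu & is_tau s mu nu.

Definition in_complete (M : set (probability borel_fwdseq R)) : Prop :=
  forall mu, M mu ->
    exists nu s, [/\ M nu, 0 < mass nu [:: s] & is_tau s nu mu].

(* Probability vectors on S^N are given by their entries. The single vertex of
   level 0 is the unique probability vector on S^0, the constant 1. *)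
Notation fvec N := {ffun N.-tuple S -> R}.

Definition marginal (N : nat) (mu : probability borel_fwdseq R) : fvec N :=
  [ffun a : N.-tuple S => mass mu a].

Definition level (M : set (probability borel_fwdseq R)) (N : nat) :
    set (fvec N) :=
  if N is 0 then [set [ffun=> 1]] else @marginal N @` M.

Definition first_mass (N : nat) (mu : fvec N.+1) (s : S) : R :=
  \sum_(a : N.+1.-tuple S | thead a == s) mu a.

(* For N = 0 this is the constant 1 as soon as [first_mass mu s] > 0. *)
Definition ftau (N : nat) (s : S) (mu : fvec N.+1) : fvec N :=
  [ffun b : N.-tuple S => mu [tuple of s :: b] / first_mass mu s].

Definition vertex := {N : nat & fvec N}.

Definition step (s : S) (u : vertex) : option vertex :=
  let: existT N mu := u in
  (if N is N'.+1 return fvec N -> option vertex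
   then fun mu => if 0 < first_mass mu s
                  then Some (existT _ N' (ftau s mu)) else None
   else fun=> None) mu.

(* tau_a = tau_(a_n) o ... o tau_(a_1), where defined. *)
Definition step_word (a : seq S) (u : vertex) : option vertex :=
  foldl (fun o s => obind (step s) o) (Some u) a.

Definition vertices (M : set (probability borel_fwdseq R)) : set vertex :=
  [set u | level M (projT2 u)].

Definition edge (M : set (probability borel_fwdseq R)) (s : S) (u v : vertex) :
    Prop :=
  [/\ vertices M u, vertices M v & step s u = Some v].

Fixpoint labeled_path (M : set (probability borel_fwdseq R)) (u : vertex)
    (w : seq S) (v : vertex) : Prop :=
  if w is s :: w' then exists2 t, edge M s u t & labeled_path M t w' v
  else vertices M u /\ u = v.

Definition presents (M : set (probability borel_fwdseq R)) (X : set (biseq S)) :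
    Prop :=
  forall w, admissible X w <-> exists u v, labeled_path M u w v.

(* Euclidean; [sup] is 0 on the empty set. *)
Definition dist (N : nat) (u v : fvec N) : R :=
  Num.sqrt (\sum_(a : N.-tuple S) (u a - v a) ^+ 2).

Definition diam (N : nat) (A : set (fvec N)) : R :=
  sup [set dist u v | u in A & v in A].

Definition contractive (M : set (probability borel_fwdseq R))
    (X : set (biseq S)) : Prop :=
  forall x, past X x ->
    diam [set nu : fvec 1 | exists2 mu : fvec n.+1, level M mu &
            step_word (past_word x n) (existT _ n.+1 mu) = Some (existT _ 1%N nu)]
      @[n --> \oo] --> 0.

End Measures.
Arguments fwdseq : clear implicits.
Arguments borel_fwdseq : clear implicits.

(* Main.v *)
Require Import Defs.
From mathcomp Require Import all_boot all_order all_algebra.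
From mathcomp Require Import all_classical all_reals all_analysis.
From mathcomp Require Import lra.

(* A word w is admissible if and only if some measure of M charges its cylinder;
   by transition completeness and compactness of X, a letter s lies in
   omega_1^+(w) as soon as every measure of M charging w also charges ws.
   Contractivity along a past makes the conditional probabilities of the next
   letter given a long enough suffix w of it almost independent of the measure.
   A letter of conditional probability at least 1/|Sigma| for one measure is
   then possible for all of them, which is property g. For property (D), extend a
   measure mu charging b s backwards by in-completeness along a word a: the
   conditional probability of s given ab stays equal to mu(bs)/mu(b) > 0, and
   contractivity applies for a long enough. *)

Set Implicit Arguments.
Unset Strict Implicit.
Unset Printing Implicit Defensive.
Import Order.TTheory GRing.Theory Num.Theory.
Import numFieldNormedType.Exports.
Local Open Scope classical_set_scope.
Local Open Scope ring_scope.

Lemma mkseqD T (f : nat -> T) m n :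
  mkseq f (m + n) = mkseq f m ++ mkseq (fun i => f (m + i)%N) n.
Proof.
by rewrite /mkseq iotaD map_cat add0n -[X in iota X n]addn0 iotaDl -map_comp.
Qed.

(** * Words, pasts and compactness of the shift space *)

Section Words.
Context {S : alphabetType}.
Implicit Types (y : nat -> S) (a w : seq S) (X : set (biseq S)).

Lemma size_past_word y n : size (past_word y n) = n.
Proof. by rewrite size_rev size_mkseq. Qed.

Lemma past_wordS y n : past_word y n.+1 = y n :: past_word y n.
Proof. by rewrite /past_word mkseqS rev_rcons. Qed.

Lemma past_word_cat y a n :
  past_word (past_cat y a) (n + size a) = past_word y n ++ a.
Proof.
rewrite /past_word addnC mkseqD rev_cat; congr (rev _ ++ _).
  by apply: eq_mkseq => i; rewrite /past_cat ltnNge leq_addr addKn.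
rewrite -[RHS]revK; congr rev.
apply: (@eq_from_nth _ point); rewrite size_mkseq ?size_rev // => i ia.
by rewrite nth_mkseq // /past_cat ia.
Qed.

Lemma past_admissible X y n : past X y -> admissible X (past_word y n).
Proof.
move=> [x Xx yx]; exists x => //; case: n => [|n].
  by exists 0.
exists (- n%:Z); rewrite size_past_word.
apply: (@eq_from_nth _ point) => [|i];
  rewrite size_past_word ?size_map ?size_iota // => ni.
rewrite nth_rev size_mkseq // nth_mkseq ?subSS ?ltnS ?leq_subr //.
rewrite (nth_map 0%N) ?size_iota // nth_iota // add0n yx; congr (x _).
by rewrite -subzn // opprB addrC.
Qed.

(** Invariance is an equality of sets, so it also yields the negative shifts. *)
Lemma shift_subshift X (i : int) x :
  subshift X -> X x -> X (fun j => x (j + i)).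
Proof.
case=> _ Xshift; elim/int_rec: i x => [|n IH|n IH] x Xx.
- by rewrite (_ : (fun _ => _) = x) //; apply/funext => j; rewrite addr0.
- have /= := IH _ Xx; rewrite -[in X in X -> _]Xshift => /=; rewrite /bishift.
  by congr X; apply/funext => j; rewrite -addn1 PoszD addrAC addrA.
- rewrite -Xshift /= /bishift; have := IH _ Xx; congr X; apply/funext => j.
  by congr (x _); rewrite -addn1 PoszD opprD [- n%:Z - _]addrC addrA addrK.
Qed.

Lemma open_coordinate (I : eqType) (i : I) (s : S) :
  open [set q : prod_topology (fun _ : I => discrete_topology S) | q i = s].
Proof.
pose p (q : prod_topology (fun _ : I => discrete_topology S)) :
  discrete_topology S := q i.
have cp : continuous p := @proj_continuous _ (fun=> discrete_topology S) i.
have os : open ([set s] : set (discrete_topology S)) by exact: discrete_open.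
by have := open_comp (fun x _ => cp x) os.
Qed.

(** Compactness: points of [X] matching ever longer suffixes of the past have a cluster point; it
    stays in the closed set [X] and matches the whole past. *)
Lemma past_cat_past X y a : subshift X ->
  (forall n, admissible X (past_word y n ++ a)) -> past X (past_cat y a).
Proof.
move=> Xsub adm; set z := past_cat y a.
have /choice[x /all_and2[Xx xz]] : forall n, exists x : biseq S,
    X x /\ forall i, (i < n)%N -> x (- i%:Z) = z i.
  move=> n.
  have [x Xx [i]] := adm n; rewrite -past_word_cat -/z size_past_word => zx.
  set m := (n + size a)%N in zx.
  (* The shift by [i + m.-1] moves the last letter of the word to coordinate 0. *)
  exists (fun j => x (j + (i + m.-1%:Z))); split.
    exact: (shift_subshift _ Xsub Xx).
  move=> j jn; have jm : (j < m)%N by apply: (leq_trans jn); exact: leq_addr.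
  have /(congr1 (fun s => nth point s (m - j.+1)%N)) := zx.
  have mj : (m - j.+1 < m)%N by rewrite ltn_subrL (leq_trans _ jm).
  rewrite (nth_map 0%N) ?size_iota // nth_iota // add0n.
  rewrite nth_rev size_mkseq // nth_mkseq; last first.
    by rewrite ltn_subrL (leq_trans _ jm).
  rewrite -subSn // subSS subKn; last exact: ltnW.
  move=> ->; congr (x _); rewrite addrC -addrA; congr (i + _).
  case: m jm {zx mj} => // m jm /=; rewrite subSS -subzn //.
have finS : finite_set [set: discrete_topology S] := @finite_finset S setT.
have cptX : compact [set: biseq S].
  have := @tychonoff int (fun=> discrete_topology S) (fun=> setT)
    (fun=> finite_compact finS).
  congr compact; by apply/seteqP; split.
have [//|p [_ clp]] := cptX (x @ \oo) _; first exact: filterT.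
have op (i : int) s : open [set q : biseq S | q i = s].
  exact: open_coordinate.
exists p.
  case: Xsub => + _; rewrite closure_id => ->; move=> B /clp; apply.
  by exists 0%N => // n _ /=; exact: Xx.
(* Fixing one coordinate of [p] gives a neighbourhood of [p], which meets every tail of [x]; far
   enough out, that coordinate is [z i]. *)
move=> i; have [q /= [-> ->]] // : [set q : biseq S | q (- i%:Z) = z i] `&`
    [set q : biseq S | q (- i%:Z) = p (- i%:Z)] !=set0.
apply: clp; last exact: open_nbhs_nbhs.
by exists i.+1 => // n /= ni; apply: xz.
Qed.

End Words.

(** * Cylinder masses and their finite marginals *)

Section Masses.
Context {R : realType} {S : alphabetType}.
Implicit Types (mu nu : probability (borel_fwdseq S) R) (a b w : seq S).

Lemma cylinder_cat w a : cylinder (w ++ a) =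
  cylinder w `&` [set x | mkseq (fun i => x (size w + i)%N) (size a) = a].
Proof.
apply/seteqP; split=> x; rewrite /cylinder /= size_cat mkseqD.
  by move/eqP; rewrite eqseq_cat ?size_mkseq // => /andP[/eqP ? /eqP].
by case=> -> ->.
Qed.

Lemma measurable_cylinder w : measurable (cylinder w).
Proof.
elim/last_ind: w => [|w s IH].
  by rewrite (_ : cylinder _ = setT) //; apply/seteqP; split.
rewrite -cats1 cylinder_cat; apply: measurableI => //.
apply: sub_sigma_algebra.
have := @open_coordinate S nat (size w) s; congr open.
by apply/seteqP; split=> x; rewrite /mkseq /= addn0; [move=> -> | case].
Qed.

Lemma mass_ge0 mu w : 0 <= mass mu w.
Proof. exact: fine_ge0. Qed.

Lemma mass_nil mu : mass mu [::] = 1.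
Proof.
rewrite /mass (_ : cylinder _ = setT) ?probability_setT //.
by apply/seteqP; split.
Qed.

(** The cylinders of the extensions of [w] by [N] letters partition that of [w]. *)
Lemma mass_cat_sum mu N w :
  mass mu w = \sum_(a : N.-tuple S) mass mu (w ++ a).
Proof.
have cylE : cylinder w = \bigcup_(a in [set: N.-tuple S]) cylinder (w ++ a).
  apply/seteqP; split=> x; last by case=> a _; rewrite cylinder_cat => -[].
  move=> wx; exists [tuple of mkseq (fun i => x (size w + i)%N) N] => //.
  by rewrite cylinder_cat; split => //=; rewrite size_mkseq.
rewrite /mass {1}cylE measure_fin_bigcup; first last.
- by move=> a _; exact: measurable_cylinder.
- move=> a b _ _ [x []]; rewrite !cylinder_cat => -[_ /= xa] [_ /= xb].
  by apply/val_inj; rewrite /= -xa -xb !size_tuple.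
- exact: finite_finset.
rewrite (fsbigE (index_enum _)) ?index_enum_uniq //; last first.
  by move=> i _; rewrite mem_index_enum.
under eq_bigl do rewrite in_setT.
transitivity (fine (\sum_(a : N.-tuple S) (mass mu (w ++ a))%:E)).
  congr fine; apply: eq_bigr => a _; rewrite /mass fineK //.
  by apply: fin_num_measure; exact: measurable_cylinder.
by rewrite sumEFin.
Qed.

Lemma mass_cat_le mu w a : mass mu (w ++ a) <= mass mu w.
Proof.
rewrite [leRHS](mass_cat_sum mu (size a)) (bigD1 (in_tuple a)) //= lerDl.
by apply: sumr_ge0 => ? _; exact: mass_ge0.
Qed.

Lemma first_mass_marginal N mu s :
  first_mass (marginal N.+1 mu) s = mass mu [:: s].
Proof.
rewrite (mass_cat_sum mu N) /first_mass.
rewrite (reindex (fun a : N.-tuple S => [tuple of s :: a])) /=.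
  by apply: eq_big => a; rewrite ?theadE ?eqxx // ffunE.
exists (fun a : N.+1.-tuple S => [tuple of behead a]) => a; rewrite inE.
  by move=> _; apply/val_inj.
by case/tupleP: a => t a; rewrite theadE => /eqP ->; apply/val_inj.
Qed.

Lemma ftau_marginal N s mu nu : is_tau s mu nu ->
  ftau s (marginal N.+1 mu) = marginal N nu.
Proof.
by move=> munu; apply/ffunP => a; rewrite !ffunE first_mass_marginal munu.
Qed.

Lemma le_dist N (u v : {ffun N.-tuple S -> R}) t : `|u t - v t| <= dist u v.
Proof.
rewrite -sqrtr_sqr ler_wsqrtr // (bigD1 t) //= lerDl.
by apply: sumr_ge0 => ? _; exact: sqr_ge0.
Qed.

(** Provides the upper bound without which a [sup] of distances says nothing. *)
Lemma dist_le_sqrt_card N (u v : {ffun N.-tuple S -> R}) :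
  (forall t, 0 <= u t <= 1) -> (forall t, 0 <= v t <= 1) ->
  dist u v <= Num.sqrt #|{:N.-tuple S}|%:R.
Proof.
move=> u01 v01; rewrite ler_wsqrtr // -sum1_card natr_sum ler_sum // => t _.
have /andP[u0 u1] := u01 t; have /andP[v0 v1] := v01 t.
rewrite -real_normK ?num_real // expr_le1 // ler_norml; lra.
Qed.

(* Meaningful only for [0 < mass mu w], as division by 0 gives 0. *)
Definition is_tau_word w mu nu :=
  forall b, mass nu b = mass mu (w ++ b) / mass mu w.

End Masses.

(** * Transitions of measures and paths in the graph *)

Section Levels.
Context {R : realType} {S : alphabetType}.
Context (M : set (probability (borel_fwdseq S) R)).
Context (M_transition : transition_complete M).
Implicit Types (mu nu : probability (borel_fwdseq S) R) (a b w : seq S).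

Definition vmarg N mu : @vertex R S := existT _ N (marginal N mu).

Lemma marginal0 mu : marginal 0 mu = [ffun => 1].
Proof. by apply/ffunP => a; rewrite !ffunE tuple0 mass_nil. Qed.

Lemma vertices_marginal N mu : M mu -> vertices M (vmarg N mu).
Proof.
case: N => [|N] Mmu; rewrite /vertices /= ?marginal0 //.
by exists mu.
Qed.

(** Level 0 is a singleton even for empty [M], hence the first hypothesis. *)
Lemma levelP N (u : {ffun N.-tuple S -> R}) :
  M !=set0 -> level M u -> exists2 mu, M mu & u = marginal N mu.
Proof.
move=> [mu Mmu]; case: N u => [|N] u /=; last by case=> nu Mnu <-; exists nu.
by move=> ->; exists mu; rewrite ?marginal0.
Qed.

Lemma step_marginal N s mu nu : is_tau s mu nu -> 0 < mass mu [:: s] ->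
  step s (vmarg N.+1 mu) = Some (vmarg N nu).
Proof.
by move=> munu mus; rewrite /= first_mass_marginal mus (ftau_marginal _ munu).
Qed.

(** Normalising factors cancel along [w], so iterated transitions amount to conditioning on the
    cylinder of [w]; one [nu] serves all levels. *)
Lemma tau_word w mu : M mu -> 0 < mass mu w -> exists nu, [/\ M nu,
  is_tau_word w mu nu &
  forall N, step_word w (vmarg (size w + N) mu) = Some (vmarg N nu)].
Proof.
elim: w mu => [|s w IH] mu Mmu muw.
  by exists mu; split => // b; rewrite mass_nil divr1.
have mus : 0 < mass mu [:: s].
  by apply: lt_le_trans muw _; rewrite -cat1s mass_cat_le.
have [nu Mnu munu] := M_transition Mmu mus.
have [|xi [Mxi nuxi stepxi]] := IH _ Mnu.
  by rewrite munu divr_gt0.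
exists xi; split => // [b|N].
  by rewrite nuxi !munu invf_div mulrA divfK ?gt_eqF.
by rewrite -stepxi /step_word -(step_marginal _ munu mus).
Qed.

(** A step is defined only at positive first mass, and these conditional masses multiply to
    [mass mu w]. *)
Lemma step_word_mass_gt0 w N mu v : M mu ->
  step_word w (vmarg (size w + N) mu) = Some v -> 0 < mass mu w.
Proof.
elim: w mu => [|s w IH] mu Mmu; first by rewrite mass_nil.
have fold0 u : foldl (fun o s => obind (@step R S s) o) None u = None.
  by elim: u.
rewrite /step_word /= first_mass_marginal; case: ifP; last by rewrite fold0.
move=> mus; have [nu Mnu munu] := M_transition Mmu mus.
rewrite (ftau_marginal _ munu) => /(IH _ Mnu).
by rewrite munu pmulr_lgt0 ?invr_gt0.
Qed.

Lemma labeled_path_mass_gt0 N w mu v : M mu ->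
  labeled_path M (vmarg N mu) w v -> 0 < mass mu w.
Proof.
elim: w N mu => [|s w IH] N mu Mmu; first by rewrite mass_nil.
case: N => [|N] [t [_ _]] //=.
rewrite first_mass_marginal; case: ifP => // mus [<-].
have [nu Mnu munu] := M_transition Mmu mus.
rewrite (ftau_marginal _ munu) => /(IH _ _ Mnu).
by rewrite munu pmulr_lgt0 ?invr_gt0.
Qed.

(** Each edge lowers the level by one, so level [size w] is just high enough. *)
Lemma mass_gt0_labeled_path w mu : M mu -> 0 < mass mu w ->
  exists v, labeled_path M (vmarg (size w) mu) w v.
Proof.
elim: w mu => [|s w IH] mu Mmu muw.
  by exists (vmarg 0 mu); split => //; exact: vertices_marginal.
have mus : 0 < mass mu [:: s].
  by apply: lt_le_trans muw _; rewrite -cat1s mass_cat_le.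
have [nu Mnu munu] := M_transition Mmu mus.
have [|v vP] := IH _ Mnu; first by rewrite munu divr_gt0.
exists v, (vmarg (size w) nu) => //; split; try exact: vertices_marginal.
exact: step_marginal.
Qed.

Context (X : set (biseq S)) (X_subshift : subshift X).
Context (M_presents : presents M X).

(** The empty path at level 0 makes the empty word admissible, so [X] has a point; one of its
    letters labels an edge leaving a positive level, made of marginals. *)
Lemma M_neq0 : M !=set0.
Proof.
have [|x Xx _] := (M_presents [::]).2.
  by exists (existT _ 0%N [ffun=> 1]), (existT _ 0%N [ffun=> 1]).
have [|[[|N] u] [v [t [uM _ ust] _]]] := (M_presents [:: x 0]).1.
- by exists x => //; exists 0; rewrite /= addr0.
- by [].
- by case: uM => mu Mmu _; exists mu.
Qed.

Lemma admissibleP w : admissible X w <-> exists2 mu, M mu & 0 < mass mu w.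
Proof.
rewrite M_presents; split=> [[[N u] [v uv]]|[mu Mmu muw]].
  have : level M u by case: w uv => [[]|s w [t []]].
  case/(levelP M_neq0) => mu Mmu uE; exists mu => //.
  by apply: (labeled_path_mass_gt0 (N := N) (v := v)); rewrite // /vmarg -uE.
by have [v ?] := mass_gt0_labeled_path Mmu muw; exists (vmarg (size w) mu), v.
Qed.

(* For a past [y] followed by [w], move [mu] along [y] into [M], where the
   hypothesis applies; compactness passes to the infinite past. *)
Lemma mem_omega1 w s :
  (forall mu, M mu -> 0 < mass mu w -> 0 < mass mu (rcons w s)) ->
  omega1 X w s.
Proof.
move=> Mws y [_ yw]; apply: past_cat_past => // n.
have /admissibleP[mu Mmu] := past_admissible (n + size w) yw.
rewrite past_word_cat => muyw; apply/admissibleP; exists mu => //.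
have [|nu [Mnu munu _]] := tau_word (w := past_word y n) Mmu.
  exact: lt_le_trans muyw (mass_cat_le _ _ _).
have muy : 0 < mass mu (past_word y n).
  exact: lt_le_trans muyw (mass_cat_le _ _ _).
have := Mws _ Mnu; rewrite !munu !pmulr_lgt0 ?invr_gt0 //; exact.
Qed.

(** * Consequences of contractivity *)

Context (M_contractive : contractive M X).

(** The entries of a level 1 vertex reached along [w] are the conditional probabilities of the next
    letter, and entrywise differences are at most the diameter. *)
Lemma contractive_mass x (e : R) : past X x -> 0 < e ->
  \forall n \near \oo, let w := past_word x n in
    forall mu nu s, M mu -> M nu -> 0 < mass mu w -> 0 < mass nu w ->
    `|mass mu (rcons w s) / mass mu w - mass nu (rcons w s) / mass nu w| < e.
Proof.
move=> Xx e0; have /cvgr0_norm_lt /(_ _ e0) := M_contractive Xx.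
apply: filterS => n; set A := (X in diam X) => diamA /=.
set w := past_word x n => mu nu s Mmu Mnu muw nuw.
have sw : size w = n by rewrite size_past_word.
have memA xi : M xi -> 0 < mass xi w -> exists2 u, A u &
    u [tuple s] = mass xi (rcons w s) / mass xi w.
  move=> Mxi xiw; have [xi' [Mxi' xixi' step1]] := tau_word Mxi xiw.
  exists (marginal 1 xi'); last by rewrite ffunE xixi' cats1.
  exists (marginal n.+1 xi); first by exists xi.
  by have := step1 1%N; rewrite sw addn1.
(* Members of [A] are marginals of measures, which bounds the distances under the [sup]. *)
have boundA u : A u -> forall t, 0 <= u t <= 1.
  move=> [_ [xi Mxi <-]]; rewrite -/w => stepu t.
  have xiw : 0 < mass xi w.
    apply: (step_word_mass_gt0 (N := 1)) Mxi _.
    by rewrite sw addn1; exact: stepu.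
  have [xi' [_ _ /(_ 1%N)]] := tau_word Mxi xiw.
  rewrite sw addn1 [LHS]stepu => uE.
  rewrite (eq_from_Tagged (@Some_inj _ _ _ uE)).
  by rewrite ffunE mass_ge0 -(mass_nil xi') -[tval t]cat0s mass_cat_le.
have [u Au us] := memA _ Mmu muw; have [v Av vs] := memA _ Mnu nuw.
rewrite -us -vs.
apply: le_lt_trans (le_dist u v _) _; apply: le_lt_trans diamA.
apply: le_trans (ler_norm _); apply: ub_le_sup; last first.
  by exists u => //; exists v.
exists (Num.sqrt #|{:1.-tuple S}|%:R) => _ [u' Au' [v' Av' <-]].
by apply: dist_le_sqrt_card; exact: boundA.
Qed.

Lemma contractive_property_g : property_g X.
Proof.
move=> x Xx; pose c : R := #|S|%:R^-1.
have S0 : (0 < #|S|)%N by apply/card_gt0P; exists point.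
have c0 : 0 < c by rewrite invr_gt0 ltr0n.
(* [Delta1] takes suffixes of length [n.+1], whence this index. *)
have [n _ /(_ n.+1 (leqnSn _)) /=] := contractive_mass Xx c0.
set w := past_word x n.+1 => close.
have /admissibleP[mu Mmu muw] := past_admissible n.+1 Xx.
rewrite -/w in muw.
have [s sP] : exists s, c <= mass mu (rcons w s) / mass mu w.
  (* Otherwise the conditional probabilities of the letters would sum to less than 1, against
     additivity. *)
  apply: contrapT => /forallNP small.
  have : \sum_(s : S) mass mu (rcons w s) / mass mu w < \sum_(s : S) c.
    apply: ltr_sum => [|s _].
      by apply/hasP; exists point => //; exact: mem_index_enum.
    by rewrite ltNge; apply/negP/small.
  rewrite sumr_const -mulr_natl mulfV ?pnatr_eq0 -?lt0n // -mulr_suml.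
  rewrite ltr_pdivrMr // mul1r (mass_cat_sum mu 1 w).
  rewrite (reindex (fun s => [tuple s])) /=.
    by under eq_bigr do rewrite -cats1; rewrite ltxx.
  exists (@thead 0 S) => a _ //.
  by case/tupleP: a => t a; apply/val_inj; rewrite (tuple0 a) /= theadE.
exists s, n => //; apply: mem_omega1 => nu Mnu nuw.
rewrite lt_neqAle mass_ge0 andbT eq_sym; apply/eqP => nu0.
(* A zero mass under [nu] would leave a gap of at least [c]. *)
have := close _ _ s Mmu Mnu muw nuw; rewrite nu0 mul0r subr0 ltNge.
by rewrite (le_trans sP) // ler_norm.
Qed.

Context (M_in : in_complete M).

Lemma contractive_property_D : property_D X.
Proof.
move=> b s /admissibleP[mu Mmu mubs].
have mub : 0 < mass mu b.
  by apply: lt_le_trans mubs _; rewrite -cats1 mass_cat_le.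
(* In-completeness extends [b] to a left-infinite past [(y, b)], generated by
   measures [nu k] in [M] all carried to the same [mu] by the words of [y]. *)
have /choice[pre preP] : forall nu, exists p : _ * S, M nu ->
    [/\ M p.1, 0 < mass p.1 [:: p.2] & is_tau p.2 p.1 nu].
  move=> nu; have [/M_in[xi [t ?]]|] := pselect (M nu).
    by exists (xi, t).
  (* Outside [M] the predecessor is an arbitrary default: choice needs a total function. *)
  by exists (nu, point).
pose nu k := iter k (fun xi => (pre xi).1) mu.
pose y k := (pre (nu k)).2.
have nuP k : [/\ M (nu k), 0 < mass (nu k) (past_word y k) &
    is_tau_word (past_word y k) (nu k) mu].
  elim: k => [|k [Mnu nuy tauk]].
    by split; rewrite // /is_tau_word ?mass_nil // => a; rewrite divr1.
  have [Mpre pre0 tau_pre] := preP _ Mnu.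
  (* The factor [mass (nu k.+1) [:: y k]] does not depend on [a], so it cancels in conditional
     probabilities. *)
  have Ek a : mass (nu k.+1) (past_word y k.+1 ++ a) =
      mass (nu k) (past_word y k ++ a) * mass (nu k.+1) [:: y k].
    by rewrite tau_pre divfK ?gt_eqF // past_wordS.
  have := Ek [::]; rewrite !cats0 => Ek0; split => // [|a].
    by rewrite Ek0 mulr_gt0.
  by rewrite tauk Ek Ek0 -mulf_div divff ?mulr1 // gt_eqF.
have nu_cat k a : 0 < mass mu a -> 0 < mass (nu k) (past_word y k ++ a).
  have [_ nuy ->] := nuP k; by rewrite pmulr_lgt0 ?invr_gt0.
have Xx : past X (past_cat y b).
  apply: past_cat_past => // k; apply/admissibleP; exists (nu k).
    by have [] := nuP k.
  exact: nu_cat.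
have p0 : 0 < mass mu (rcons b s) / mass mu b by rewrite divr_gt0.
(* At length [n + size b] the suffix splits as [past_word y n ++ b]. *)
have [n _ /(_ (n + size b)%N (leq_addr _ _)) /=] := contractive_mass Xx p0.
rewrite past_word_cat => close; have [Mnu nuy tau_nu] := nuP n.
exists (past_word y n).
  by apply/admissibleP; exists (nu n) => //; exact: nu_cat.
apply: mem_omega1 => xi Mxi xiw.
rewrite lt_neqAle mass_ge0 andbT eq_sym; apply/eqP => xi0.
have := close _ _ s Mnu Mxi (nu_cat n b mub) xiw.
(* Under [nu n] the conditional probability of [s] is exactly the chosen threshold, which
   contradicts the strict bound. *)
rewrite xi0 mul0r subr0 rcons_cat !tau_nu invf_div mulrA divfK ?gt_eqF //.
by rewrite ger0_norm ?ltxx // divr_ge0 ?mass_ge0.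
Qed.

End Levels.

Theorem theorem3p5 (R : realType) (S : alphabetType) (X : set (biseq S))
    (M : set (probability (borel_fwdseq S) R))
    (X_subshift : subshift X)
    (M_transition : transition_complete M) (M_in : in_complete M)
    (M_presents : presents M X) (M_contractive : contractive M X) :
  property_g X /\ property_D X.
Proof.
split; first exact: (contractive_property_g M_transition X_subshift M_presents).
exact: (contractive_property_D M_transition X_subshift M_presents _ M_in).
Qed.
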